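(* Let $h$ be a nonconstant harmonic function on $SG$ with $\nu_h=a\nu_0+b\nu_1+c\nu_2$ ($a,b,c\in\mathbb{R}$), and let $h^\perp$ be a harmonic function with $\mathcal{E}(h^\perp)=1$ and $\mathcal{E}(h,h^\perp)=0$. Let $C$ be a cell of $SG$. Then: a) $\displaystyle\inf_{x\in C}\frac{d\nu_h}{d\nu}(x)=0$; b) $\displaystyle\sup_{x\in C}\frac{d\nu_h}{d\nu}(x)=\frac23(a+b+c)$, and if the maximum of $\frac{d\nu_h}{d\nu}$ is attained at a point, then the minimum of $\frac{d\nu_{h^\perp}}{d\nu}$ is attained at the same point.
   Context: Let $q_0,q_1,q_2$ be the vertices of an equilateral triangle in $\mathbb{R}^2$, $F_i(x)=\frac12(x+q_i)$, and let $SG$ be the unique nonempty compact set with $SG=\bigcup_{i=0}^2F_i(SG)$. For a finite (possibly empty) word $w=(w_1,\dots,w_m)$ in $\{0,1,2\}$ put $|w|=m$, $F_w=F_{w_1}\circ\cdots\circ F_{w_m}$; the sets $F_wSG$ are the cells of $SG$. For continuous $u,v$ on $SG$ put $\mathcal{E}_m(u,v)=\left(\frac53\right)^m\sum_{|w|=m}\sum_{i<j}(u(F_wq_i)-u(F_wq_j))(v(F_wq_i)-v(F_wq_j))$, $\mathcal{E}(u,v)=\lim_m\mathcal{E}_m(u,v)$ (finite energy), $\mathcal{E}(u)=\mathcal{E}(u,u)$. A function $h$ is harmonic if $\mathcal{E}_m(h,h)$ is independent of $m$; harmonic functions are uniquely determined by arbitrary values at $q_0,q_1,q_2$, and $h_i$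 is the harmonic function with $h_i(q_j)=\delta_{ij}$. For $h$ harmonic, $\nu_h$ is the finite Borel measure on $SG$ with $\nu_h(F_wSG)=\left(\frac53\right)^{|w|}\mathcal{E}(h\circ F_w)$ for all $w$. Write $\nu_i=\nu_{h_i}$ and $\nu=\nu_0+\nu_1+\nu_2$ (Kusuoka measure). The measures $\nu_0,\nu_1,\nu_2$ are linearly independent and each $\nu_h$ is a linear combination of them. Values of the Radon-Nikodym derivative are taken pointwise: $\frac{d\nu_h}{d\nu}(x)=\lim_n \nu_h(C_n)/\nu(C_n)$, where $C_n$ is a decreasing sequence of cells of level $n$ (i.e. $C_n=F_{w}SG$, $|w|=n$) containing $x$, at the points where this limit exists. (The limit exists at every vertex $F_wq_j$, independently of the choice of the sequence; for other $x$ the sequence is unique and the limit exists for $\nu$-a.e. $x$.) Infima, suprema, maxima and minima are over the points where the derivative is defined. *)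

(* Defs.v *)
From HB Require Import structures.
From mathcomp Require Import all_boot all_order all_algebra.
From mathcomp Require Import all_classical all_reals all_analysis.

Set Implicit Arguments.
Unset Strict Implicit.
Unset Printing Implicit Defensive.

Import Order.TTheory GRing.Theory Num.Theory.
Import numFieldNormedType.Exports.

Local Open Scope classical_set_scope.
Local Open Scope ring_scope.

(* [`|x - y|] on [R * R] is the sup norm, hence an explicit Euclidean one. *)
Definition euclid_dist (R : realType) (x y : R * R) : R :=
  Num.sqrt ((x.1 - y.1) ^+ 2 + (x.2 - y.2) ^+ 2).

Definition equilateral (R : realType) (q : 'I_3 -> R * R) : Prop :=
  exists2 s : R, 0 < s & forall i j, i != j -> euclid_dist (q i) (q j) = s.

Definition Fmap (R : realType) (q : 'I_3 -> R * R) (i : 'I_3) (x : R * R)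
    : R * R :=
  ((x.1 + (q i).1) / 2, (x.2 + (q i).2) / 2).

Fixpoint Fword (R : realType) (q : 'I_3 -> R * R) (w : seq 'I_3) (x : R * R)
    : R * R :=
  if w is i :: w' then Fmap q i (Fword q w' x) else x.

Definition is_gasket (R : realType) (q : 'I_3 -> R * R) (K : set (R * R))
    : Prop :=
  [/\ K !=set0, compact K & K = \bigcup_(i in [set: 'I_3]) (Fmap q i @` K)].

Definition is_cell (R : realType) (q : 'I_3 -> R * R) (K : set (R * R))
    (n : nat) (C : set (R * R)) : Prop :=
  exists2 w : seq 'I_3, size w = n & C = Fword q w @` K.

(* Functions on the gasket [K] are represented by functions on the plane, of
   which only the values on [K] are ever used. *)
Definition energy_level (R : realType) (q : 'I_3 -> R * R) (m : nat)
    (u v : R * R -> R) : R :=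
  (5 / 3) ^+ m *
  \sum_(w : m.-tuple 'I_3) \sum_(i < 3) \sum_(j < 3 | (i < j)%N)
    (u (Fword q w (q i)) - u (Fword q w (q j))) *
    (v (Fword q w (q i)) - v (Fword q w (q j))).

(* [lim] is total; below it is only applied where the sequence is convergent
   (in fact constant), namely to harmonic functions. *)
Definition energy (R : realType) (q : 'I_3 -> R * R) (u v : R * R -> R) : R :=
  lim ((fun m => energy_level q m u v) @ \oo).

Definition harmonic_on (R : realType) (q : 'I_3 -> R * R) (K : set (R * R))
    (h : R * R -> R) : Prop :=
  {within K, continuous h} /\
  forall m n, energy_level q m h h = energy_level q n h h.

(* A measure on [K] is a measure on the plane that does not charge the
   complement of [K]; the product sigma-algebra on [R * R] is the Borel one. *)
Definition is_energy_measure (R : realType) (q : 'I_3 -> R * R)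
    (K : set (R * R)) (h : R * R -> R)
    (mu : {finite_measure set (R * R)%type -> \bar R}) : Prop :=
  mu (~` K) = 0%E /\
  forall w : seq 'I_3, mu (Fword q w @` K) =
    ((5 / 3) ^+ size w * energy q (h \o Fword q w) (h \o Fword q w))%:E.

Definition kusuoka (R : realType)
    (nu : 'I_3 -> {finite_measure set (R * R)%type -> \bar R})
    (A : set (R * R)) : \bar R :=
  (\sum_(i < 3) nu i A)%E.

Definition cell_seq (R : realType) (q : 'I_3 -> R * R) (K : set (R * R))
    (x : R * R) (C : nat -> set (R * R)) : Prop :=
  forall n, [/\ is_cell q K n (C n), C n.+1 `<=` C n & C n x].

(* [RNderiv q K mu nu x l]: the pointwise derivative of [mu] with respect to
   [nu] is defined at [x] and is equal to [l]. Vertices have two sequences of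
   cells, and both must give the same limit. *)
Definition RNderiv (R : realType) (q : 'I_3 -> R * R) (K : set (R * R))
    (mu nu : set (R * R) -> \bar R) (x : R * R) (l : R) : Prop :=
  K x /\
  forall C : nat -> set (R * R), cell_seq q K x C ->
    (fun n => fine (mu (C n)) / fine (nu (C n))) @ \oo --> l.

Definition RNvalues (R : realType) (q : 'I_3 -> R * R) (K : set (R * R))
    (mu nu : set (R * R) -> \bar R) (C : set (R * R)) : set R :=
  [set l | exists2 x, C x & RNderiv q K mu nu x l].

Definition RNmax_at (R : realType) (q : 'I_3 -> R * R) (K : set (R * R))
    (mu nu : set (R * R) -> \bar R) (C : set (R * R)) (x : R * R) : Prop :=
  C x /\ exists2 l, RNderiv q K mu nu x l & ubound (RNvalues q K mu nu C) l.

Definition RNmin_at (R : realType) (q : 'I_3 -> R * R) (K : set (R * R))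
    (mu nu : set (R * R) -> \bar R) (C : set (R * R)) (x : R * R) : Prop :=
  C x /\ exists2 l, RNderiv q K mu nu x l & lbound (RNvalues q K mu nu C) l.

(* Main.v *)
Require Import Defs.
From HB Require Import structures.
From mathcomp Require Import all_boot all_order all_algebra.
From mathcomp Require Import all_classical all_reals all_analysis.
From mathcomp Require Import ring lra.
Import Order.TTheory GRing.Theory Num.Theory.
Import numFieldNormedType.Exports.
Local Open Scope classical_set_scope.
Local Open Scope ring_scope.

(** The energy of a harmonic function depends only on its corner values, and on
    each subcell these are transformed linearly; so the mass that its energy
    measure gives to the cell of a word [w] is a quadratic form in the corner
    values. Modulo constants the corner values form a plane, with the energy as
    Euclidean structure. Dually one follows the zero-sum functionals [l] on
    corner values: the transposed restriction map is, up to the factor 5,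
    [dual_ext i], with eigenvalue 3 on the normal derivative at the corner [i]
    and eigenvalue 1 on the antisymmetric functional.

    Two facts give the theorem. The first is Pythagoras in this plane: for [h]
    with energy [e], orthogonal to [hperp] of energy 1, the measure of [h] plus
    [e] times that of [hperp] is [e / 3] times the Kusuoka measure on every cell
    ([cell_mass_split]). Hence all derivatives of the measure of [h] lie in
    [0, e / 3], and those of [h] and [hperp] determine each other
    ([RNderiv_orthogonal]): the first has the value [e / 3] exactly where the
    second vanishes. The total masses give [e = 2 (a + b + c)].

    The second is density. Along the cells shrinking to a vertex, the eigenvalue
    3 dominates, so the derivative at the vertex is [(l . t)^2 / |l|^2], where
    [t] are the corner values of [h] and [l] is the functional giving the normal
    derivative there ([cell_ratio_cvg], [RNderiv_vertex]). The two cells that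
    meet at a vertex have proportional functionals, so they agree on the limit
    ([vertex_flux]). The directions of these [l] are dense among all directions:
    in a suitable slope coordinate the maps [dual_ext i] become two contractions
    of [1, 2] whose images cover [1, 2] ([slope_dense]). Since the restriction
    maps are invertible, density persists inside any cell
    ([vertex_value_dense]). Choosing [l] near the direction of [hperp] makes the
    derivative close to 0, and near the direction of [h] close to [e / 3]. *)

Set Implicit Arguments.
Unset Strict Implicit.

(** * Energy forms on three vertices *)

Lemma ord3_ind (P : 'I_3 -> Prop) : P 0 -> P 1 -> P 2 -> forall i, P i.
Proof.
move=> P0 P1 P2 [[|[|[|//]]] lti].
- by rewrite (_ : Ordinal _ = 0) //; exact: val_inj.
- by rewrite (_ : Ordinal _ = 1) //; exact: val_inj.
- by rewrite (_ : Ordinal _ = 2) //; exact: val_inj.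
Qed.

Lemma sum_ord3 (V : nmodType) (f : 'I_3 -> V) :
  \sum_(i < 3) f i = f 0 + f 1 + f 2.
Proof.
rewrite !big_ord_recl big_ord0 addr0 addrA.
by congr (_ + f _ + f _); exact: val_inj.
Qed.

Section Vectors.
Context {R : realFieldType}.
Implicit Types (l s t : 'I_3 -> R) (i j k : 'I_3) (w : seq 'I_3).

Definition dot s t : R := \sum_(i < 3) s i * t i.

Definition edge_form s t : R :=
  \sum_(i < 3) \sum_(j < 3 | (i < j)%N) (s i - s j) * (t i - t j).

Definition unit_vec i : 'I_3 -> R := fun j => (i == j)%:R.

Definition zero_sum l := \sum_(i < 3) l i = 0.

(** Values at the corners of the [i]-th subcell of the harmonic function with
    corner values [t]; off the diagonal this is the usual
    (2/5, 2/5, 1/5) rule. *)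
Definition harm_ext i t : 'I_3 -> R :=
  fun j => if j == i then t i else (t i + t j + \sum_(k < 3) t k) / 5.

Definition harm_word w t : 'I_3 -> R := foldl (fun t i => harm_ext i t) t w.

(** Five times the transpose of [harm_ext i], restricted to zero-sum
    functionals. *)
Definition dual_ext i l : 'I_3 -> R :=
  fun j => l j - l i + (j == i)%:R * (3 * l i).

Definition dual_word w l : 'I_3 -> R := foldr dual_ext l w.

(** The functional giving the normal derivative at the [i]-th corner; an
    eigenvector of [dual_ext i] for its largest eigenvalue 3. *)
Definition flux_fun i : 'I_3 -> R := fun j => 3 * (i == j)%:R - 1.

(** The eigenvector of [dual_ext i] for its other eigenvalue 1. *)
Definition skew_fun i : 'I_3 -> R :=
  fun j => (j == i + 1)%:R - (j == i + 2)%:R.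

Lemma edge_formE s t : edge_form s t =
  (s 0 - s 1) * (t 0 - t 1) + (s 0 - s 2) * (t 0 - t 2)
  + (s 1 - s 2) * (t 1 - t 2).
Proof.
rewrite /edge_form; under eq_bigr do rewrite big_mkcond sum_ord3 /=.
by rewrite sum_ord3 /=; ring.
Qed.

Lemma edge_formC s t : edge_form s t = edge_form t s.
Proof. by rewrite !edge_formE; ring. Qed.

Lemma dotE s t : dot s t = s 0 * t 0 + s 1 * t 1 + s 2 * t 2.
Proof. exact: sum_ord3. Qed.

Lemma edge_form_ge0 t : 0 <= edge_form t t.
Proof. by rewrite edge_formE -!expr2 !addr_ge0 ?sqr_ge0. Qed.

Lemma dot_self_ge0 t : 0 <= dot t t.
Proof. by rewrite dotE -!expr2 !addr_ge0 ?sqr_ge0. Qed.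

Lemma dot_self_gt0 l i : l i != 0 -> 0 < dot l l.
Proof.
move=> li; rewrite /dot (bigD1 i) //= -expr2 ltr_pwDl //.
  by rewrite exprn_even_gt0.
by apply: sumr_ge0 => j _; rewrite -expr2 sqr_ge0.
Qed.

(** The energy form in the eigenbasis of the [i]-th restriction map. *)
Lemma edge_form_split i s : edge_form s s =
  2^-1 * dot (flux_fun i) s ^+ 2 + 3 / 2 * dot (skew_fun i) s ^+ 2.
Proof.
rewrite edge_formE !dotE /flux_fun /skew_fun.
by move: i; apply: ord3_ind => /=; field.
Qed.

(** The minimum of the energy over the values at the three midpoints is
    attained at the harmonic extension only; the statement keeps the six values
    at the corners of the subcells, with the midpoints identified. *)
Lemma edge_form_ext_min (t : 'I_3 -> R) (s : 'I_3 -> 'I_3 -> R) :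
    (forall i, s i i = t i) -> (forall i j, s i j = s j i) ->
  edge_form t t <= 5 / 3 * \sum_(i < 3) edge_form (s i) (s i) /\
  (edge_form t t = 5 / 3 * \sum_(i < 3) edge_form (s i) (s i) ->
   forall i j, s i j = harm_ext i t j).
Proof.
move=> sd ss; rewrite sum_ord3 !edge_formE !sd.
rewrite (ss 1 0) (ss 2 0) (ss 2 1).
set S := t 0 + t 1 + t 2.
pose x := s 1 2 - (t 1 + t 2 + S) / 5.
pose y := s 0 2 - (t 0 + t 2 + S) / 5.
pose z := s 0 1 - (t 0 + t 1 + S) / 5.
have -> : s 1 2 = x + (t 1 + t 2 + S) / 5 by rewrite /x; ring.
have -> : s 0 2 = y + (t 0 + t 2 + S) / 5 by rewrite /y; ring.
have -> : s 0 1 = z + (t 0 + t 1 + S) / 5 by rewrite /z; ring.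
set E0 := (X in X <= _); set E1 := (X in _ <= X).
have E01 : E1 = E0 + 5 / 3 * (2 * (x ^+ 2 + y ^+ 2 + z ^+ 2)
    + (x - y) ^+ 2 + (y - z) ^+ 2 + (x - z) ^+ 2).
  by rewrite /E1 /E0 /S; field.
have sum_squares (a b c d e f : R) : 0 <= a -> 0 <= b -> 0 <= c ->
    0 <= d -> 0 <= e -> 0 <= f ->
    0 <= 5 / 3 * (2 * (a + b + c) + d + e + f) /\
    (5 / 3 * (2 * (a + b + c) + d + e + f) = 0 -> [/\ a = 0, b = 0 & c = 0]).
  by move=> *; split=> [|?]; [lra|split; lra].
have [Q0 Qeq0] := sum_squares _ _ _ _ _ _ (sqr_ge0 x) (sqr_ge0 y) (sqr_ge0 z)
  (sqr_ge0 (x - y)) (sqr_ge0 (y - z)) (sqr_ge0 (x - z)).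
rewrite -/E1 -/E0 E01; split=> [|/esym/(canRL (addKr _))]; first by rewrite lerDl.
rewrite addNr => /Qeq0[/eqP x0 /eqP y0 /eqP z0].
move: x0 y0 z0; rewrite !sqrf_eq0 => /eqP x0 /eqP y0 /eqP z0.
have e12 : s 1 2 = (t 1 + t 2 + S) / 5 by apply/eqP; rewrite -subr_eq0 -/x x0.
have e02 : s 0 2 = (t 0 + t 2 + S) / 5 by apply/eqP; rewrite -subr_eq0 -/y y0.
have e01 : s 0 1 = (t 0 + t 1 + S) / 5 by apply/eqP; rewrite -subr_eq0 -/z z0.
rewrite /harm_ext sum_ord3 -/S.
apply: ord3_ind; apply: ord3_ind => //=; rewrite ?(ss 1 0) ?(ss 2 0) ?(ss 2 1);
  rewrite ?e12 ?e02 ?e01; congr (_ / 5); ring.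
Qed.

Lemma edge_form_harm_ext s t :
  5 / 3 * \sum_(i < 3) edge_form (harm_ext i s) (harm_ext i t) = edge_form s t.
Proof. by rewrite sum_ord3 !edge_formE /harm_ext !sum_ord3 /=; field. Qed.

(** * The dual action on zero-sum functionals *)

Lemma zero_sum_dual_ext i l : zero_sum l -> zero_sum (dual_ext i l).
Proof.
rewrite /zero_sum !sum_ord3 /dual_ext => l0.
by move: i; apply: ord3_ind => /=; rewrite -l0; ring.
Qed.

Lemma zero_sum_dual_word w l : zero_sum l -> zero_sum (dual_word w l).
Proof. by move=> l0; elim: w => //= i w; exact: zero_sum_dual_ext. Qed.

Lemma dot_harm_ext i l t : zero_sum l ->
  dot l (harm_ext i t) = 5^-1 * dot (dual_ext i l) t.
Proof.
rewrite /zero_sum sum_ord3 !dotE /harm_ext /dual_ext !sum_ord3 => l0.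
have l2 : l 2 = - l 0 - l 1 by rewrite -[RHS]add0r -l0; ring.
by move: i; apply: ord3_ind => /=; rewrite ?l2; field.
Qed.

Lemma dot_harm_word w l t : zero_sum l ->
  dot l (harm_word w t) = 5^-1 ^+ size w * dot (dual_word w l) t.
Proof.
move=> l0; elim: w t => [|i w IH] t; first by rewrite mul1r.
rewrite [size _]/= exprSr -mulrA -dot_harm_ext.
  exact: IH.
exact: zero_sum_dual_word.
Qed.

Lemma zero_sum_flux i : zero_sum (flux_fun i).
Proof.
by rewrite /zero_sum sum_ord3 /flux_fun; move: i; apply: ord3_ind => /=; ring.
Qed.

Lemma zero_sum_skew i : zero_sum (skew_fun i).
Proof.
by rewrite /zero_sum sum_ord3 /skew_fun; move: i; apply: ord3_ind => /=; ring.
Qed.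

Lemma dual_ext_scale i (x : R) l :
  dual_ext i (fun j => x * l j) = fun j => x * dual_ext i l j.
Proof. by apply/funext => j; rewrite /dual_ext; ring. Qed.

Lemma dual_word_scale w (x : R) l :
  dual_word w (fun j => x * l j) = fun j => x * dual_word w l j.
Proof. by elim: w => //= i w ->; exact: dual_ext_scale. Qed.

Lemma dual_ext_flux i : dual_ext i (flux_fun i) = fun j => 3 * flux_fun i j.
Proof.
apply/funext; rewrite /dual_ext /flux_fun.
by move: i; apply: ord3_ind; apply: ord3_ind => /=; ring.
Qed.

Lemma dual_ext_skew i : dual_ext i (skew_fun i) = skew_fun i.
Proof.
apply/funext; rewrite /dual_ext /skew_fun.
by move: i; apply: ord3_ind; apply: ord3_ind => /=; ring.
Qed.

(** Both sides are the normal derivative at the vertex common to the subcells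
    [i] and [j], seen from either side; the two outward directions are
    opposite. *)
Lemma dual_ext_flux_swap i j : i != j ->
  dual_ext i (flux_fun j) = fun k => -1 * dual_ext j (flux_fun i) k.
Proof.
move=> ij; apply/funext => k; move: i j k ij; rewrite /dual_ext /flux_fun.
by apply: ord3_ind; apply: ord3_ind; apply: ord3_ind => //= _; ring.
Qed.

Lemma dual_ext_eq0 i l : (forall j, dual_ext i l j = 0) -> forall j, l j = 0.
Proof.
move=> Tl0 j; have := Tl0 i; have := Tl0 j; rewrite /dual_ext eqxx.
by case: (j =P i) => [->|_]; rewrite ?mul0r ?mul1r; lra.
Qed.

Lemma dual_word_flux_neq0 w i : exists j, dual_word w (flux_fun i) j != 0.
Proof.
apply: contrapT => /forallNP H.
have {}H j : dual_word w (flux_fun i) j = 0 by apply/eqP/negPn/negP/H.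
suff : flux_fun i i = 0 by rewrite /flux_fun eqxx /=; lra.
by elim: w H => [H|a w IH H]; [exact: H|apply: IH; exact: dual_ext_eq0 H].
Qed.

Lemma dual_word_onto w l : zero_sum l ->
  exists2 s, zero_sum s & dual_word w s = l.
Proof.
elim: w l => [|i w IH] l l0 /=; first by exists l.
pose r j := if j == i then l i / 3 else l j + l i / 3.
have r0 : zero_sum r.
  move: l0; rewrite /zero_sum !sum_ord3 => <-; rewrite /r; clear r.
  by move: i; apply: ord3_ind => /=; field.
have [s s0 sr] := IH r r0; exists s => //; rewrite sr; apply/funext => j.
by rewrite /dual_ext /r eqxx; case: (j =P i) => [->|_] /=; field.
Qed.

(** Pythagoras in the plane of corner values modulo constants, with the energy as
    squared norm: the dual norm of [l] is [dot l l / 3], and the orthogonal pair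
    [t], [p] gives two coordinates of [l]. *)
Lemma dot_orthogonal_split l t p : zero_sum l ->
    edge_form p p = 1 -> edge_form t p = 0 ->
  3 * (dot l t ^+ 2 + edge_form t t * dot l p ^+ 2) = edge_form t t * dot l l.
Proof.
rewrite /zero_sum sum_ord3 => l0 pp tp.
have cramer : 3 * (dot l t ^+ 2 * edge_form p p + edge_form t t * dot l p ^+ 2
      - 2 * edge_form t p * dot l t * dot l p) =
    (edge_form t t * edge_form p p - edge_form t p ^+ 2) * dot l l.
  rewrite !edge_formE !dotE.
  have -> : l 2 = - l 0 - l 1 by rewrite -[RHS]add0r -l0; ring.
  ring.
by move: cramer; rewrite pp tp; lra.
Qed.

Lemma dot_unit_vec l i : dot l (unit_vec i) = l i.
Proof. by rewrite dotE /unit_vec; move: i; apply: ord3_ind => /=; ring. Qed.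

Lemma sum_dot_unit_vec l : \sum_(i < 3) dot l (unit_vec i) ^+ 2 = dot l l.
Proof. by rewrite sum_ord3 !dot_unit_vec dotE. Qed.

(** The energy measure of the cell [w], without the factor [(5/3)^|w|], which
    cancels in quotients. *)
Definition cell_mass w t : R := edge_form (harm_word w t) (harm_word w t).

Definition kusuoka_mass w : R := \sum_(i < 3) cell_mass w (unit_vec i).

Lemma cell_massE i w t : cell_mass w t = (5^-1 ^+ size w) ^+ 2 *
  (2^-1 * dot (dual_word w (flux_fun i)) t ^+ 2
   + 3 / 2 * dot (dual_word w (skew_fun i)) t ^+ 2).
Proof.
rewrite /cell_mass (edge_form_split i) !dot_harm_word;
  [|exact: zero_sum_skew|exact: zero_sum_flux].
by rewrite !exprMn; ring.
Qed.

Lemma kusuoka_massE i w : kusuoka_mass w = (5^-1 ^+ size w) ^+ 2 *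
  (2^-1 * dot (dual_word w (flux_fun i)) (dual_word w (flux_fun i))
   + 3 / 2 * dot (dual_word w (skew_fun i)) (dual_word w (skew_fun i))).
Proof.
rewrite /kusuoka_mass; under eq_bigr do rewrite (cell_massE i).
by rewrite -mulr_sumr big_split /= -!mulr_sumr !sum_dot_unit_vec.
Qed.

Lemma cell_mass_ge0 w t : 0 <= cell_mass w t.
Proof. exact: edge_form_ge0. Qed.

Lemma kusuoka_mass_gt0 w : 0 < kusuoka_mass w.
Proof.
have [j wj] := dual_word_flux_neq0 w 0.
rewrite (kusuoka_massE 0) mulr_gt0 ?exprn_gt0 ?invr_gt0 //.
apply: ltr_pwDl.
  by apply: mulr_gt0; [rewrite invr_gt0|exact: dot_self_gt0 wj].
by apply: mulr_ge0; [rewrite divr_ge0|exact: dot_self_ge0].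
Qed.

(** For orthogonal [t] and [p] the normalised energy measures add up to one
    third of the Kusuoka measure on every cell. *)
Lemma cell_mass_split w t p : edge_form p p = 1 -> edge_form t p = 0 ->
  cell_mass w t + edge_form t t * cell_mass w p =
  edge_form t t / 3 * kusuoka_mass w.
Proof.
move=> pp tp; rewrite !(cell_massE 0) (kusuoka_massE 0).
have lN := zero_sum_dual_word w (zero_sum_flux 0).
have lS := zero_sum_dual_word w (zero_sum_skew 0).
move: (dot_orthogonal_split lN pp tp) (dot_orthogonal_split lS pp tp) => {lN lS}.
move: (dual_word w (flux_fun 0)) (dual_word w (skew_fun 0)) => l l'.
move: (5^-1 ^+ size w) (edge_form t t) => c e.
move=> /(canRL (mulKf _)) El /(canRL (mulKf _)) El'.
have -> : dot l t ^+ 2 = 3^-1 * (e * dot l l) - e * dot l p ^+ 2.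
  by rewrite -El ?pnatr_eq0 //; ring.
have -> : dot l' t ^+ 2 = 3^-1 * (e * dot l' l') - e * dot l' p ^+ 2.
  by rewrite -El' ?pnatr_eq0 //; ring.
by field.
Qed.

End Vectors.

(** * Directions of normal derivatives are dense *)

Section Directions.
Context {R : realFieldType}.
Implicit Types (l s t : 'I_3 -> R) (i j : 'I_3) (w : seq 'I_3).

(** Being a multiple of the normal derivative at some vertex. *)
Definition normal_dir l := exists (c : R) w i,
  c != 0 /\ l = fun j => c * dual_word w (flux_fun i) j.

Lemma normal_dir_dual_ext i l : normal_dir l -> normal_dir (dual_ext i l).
Proof.
by move=> [c [w [j [c0 ->]]]]; exists c, (i :: w), j; rewrite dual_ext_scale.
Qed.

Lemma normal_dir_scale (c : R) l : c != 0 -> normal_dir l ->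
  normal_dir (fun j => c * l j).
Proof.
move=> c0 [d [w [i [d0 ->]]]]; exists (c * d), w, i; split.
  by rewrite mulf_neq0.
by apply/funext => j; rewrite mulrA.
Qed.

Lemma normal_dir_unscale (c : R) l : c != 0 ->
  normal_dir (fun j => c * l j) -> normal_dir l.
Proof.
move=> c0 /(normal_dir_scale (invr_neq0 c0)).
by under [X in normal_dir X]eq_fun do rewrite mulKf //.
Qed.

(** Up to permutation and scaling each zero-sum functional has coordinates
    [q], [-1], [1 - q] with [q] between 1 and 2: [i] carries the coordinate of
    largest modulus, [j] the second one. *)
Definition slope_fun (q : R) i j : 'I_3 -> R :=
  fun k => if k == i then q else if k == j then -1 else 1 - q.

Lemma slope_fun2 i j : i != j -> slope_fun 2 i j = flux_fun i.
Proof.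
move=> ij; apply/funext => k; rewrite /slope_fun /flux_fun; move: ij.
by move: i j k; apply: ord3_ind; apply: ord3_ind; apply: ord3_ind => //= _; ring.
Qed.

Lemma dual_ext_slope q i j : i != j -> 1 + q != 0 ->
  dual_ext i (slope_fun q i j) =
  fun k => (1 + q) * slope_fun (3 * q / (1 + q)) i j k.
Proof.
move=> ij q1; apply/funext => k; move: ij; rewrite /dual_ext /slope_fun.
by move: i j k; apply: ord3_ind; apply: ord3_ind; apply: ord3_ind => //= _; field.
Qed.

Lemma dual_ext_slope_swap q i j : i != j -> 1 + q != 0 ->
  dual_ext i (slope_fun q j i) =
  fun k => - (1 + q) * slope_fun (3 / (1 + q)) i j k.
Proof.
move=> ij q1; apply/funext => k; move: ij; rewrite /dual_ext /slope_fun.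
by move: i j k; apply: ord3_ind; apply: ord3_ind; apply: ord3_ind => //= _; field.
Qed.

(** The maps [q |-> 3 q / (1 + q)] and [q |-> 3 / (1 + q)] contract [1, 2] by
    3/4 and their images [3/2, 2] and [1, 3/2] cover it. Hence, as in any
    iterated function system, the orbit of the point 2 is dense. *)
Lemma slope_dense n i j (q : R) : i != j -> 1 <= q <= 2 ->
  exists2 q', `|q - q'| <= (3 / 4) ^+ n & 1 <= q' <= 2 /\
    normal_dir (slope_fun q' i j).
Proof.
elim: n i j q => [|n IH] i j q ij /andP[q1 q2].
  exists 2; first by rewrite expr0 ler_norml; apply/andP; split; lra.
  split; first by apply/andP; split; lra.
  rewrite slope_fun2 //; exists 1, [::], i; split; first exact: oner_neq0.
  by apply/funext => k; rewrite mul1r.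
have contract (x y : R) : 1 <= x -> 1 <= y ->
    `|3 / (1 + x) - 3 / (1 + y)| <= 3 / 4 * `|x - y|.
  move=> x1 y1; have -> : 3 / (1 + x) - 3 / (1 + y) =
      3 / ((1 + x) * (1 + y)) * (y - x).
    by field; apply/andP; split; lra.
  rewrite normrM distrC ler_wpM2r // ger0_norm; last first.
    by rewrite divr_ge0 // mulr_ge0 //; lra.
  by rewrite ler_pdivrMr; nra.
case: (leP (3 / 2) q) => qh.
- pose y := q / (3 - q).
  have y1 : 1 <= y by rewrite ler_pdivlMr; lra.
  have y2 : y <= 2 by rewrite ler_pdivrMr; lra.
  have [|y' yy' [/andP[y'1 y'2] Dy']] := IH i j y ij; first by rewrite y1.
  exists (3 * y' / (1 + y')).
    rewrite exprS; apply: le_trans (ler_wpM2l _ yy'); last by lra.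
    have -> : q - 3 * y' / (1 + y') = - (3 / (1 + y) - 3 / (1 + y')).
      by rewrite /y; field; rewrite lt0r_neq0 ?lt0r_neq0; lra.
    by rewrite normrN contract.
  split; first by rewrite ler_pdivlMr ?ler_pdivrMr; lra.
  have := normal_dir_dual_ext i Dy'; rewrite dual_ext_slope //; last by lra.
  by apply: normal_dir_unscale; lra.
- pose y := 3 / q - 1.
  have q0 : 0 < q by lra.
  have y1 : 1 <= y by rewrite lerBrDr ler_pdivlMr //; lra.
  have y2 : y <= 2 by rewrite lerBlDr ler_pdivrMr //; lra.
  have ji : j != i by rewrite eq_sym.
  have [|y' yy' [/andP[y'1 y'2] Dy']] := IH j i y ji; first by rewrite y1.
  exists (3 / (1 + y')).
    rewrite exprS; apply: le_trans (ler_wpM2l _ yy'); last by lra.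
    have -> : q = 3 / (1 + y).
      by rewrite /y addrC subrK invf_div mulrC divfK // pnatr_eq0.
    exact: contract.
  split; first by rewrite ler_pdivlMr ?ler_pdivrMr; lra.
  have := normal_dir_dual_ext i Dy'; rewrite dual_ext_slope_swap //; last by lra.
  by apply: normal_dir_unscale; lra.
Qed.

Lemma slope_funE l i j m : uniq [:: i; j; m] -> l i + l j + l m = 0 ->
  l j != 0 -> l = fun k => - l j * slope_fun (- l i / l j) i j k.
Proof.
move=> u e lj; apply/funext => k; rewrite /slope_fun.
have -> : l k = if k == i then l i else if k == j then l j else l m.
  move: u => {e lj}; move: i j m k.
  by do 4!(apply: ord3_ind => //).
case: (k == i); first by field.
case: (k == j); first by ring.
by have -> : l m = - l i - l j by [lra]; field.
Qed.

(** In a zero-sum functional the coordinate of largest modulus is opposite in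
    sign to the other two, so it is the maximum or the minimum according to the
    sign of the middle one; the other extreme comes second. *)
Lemma slope_fun_normal_form l k : zero_sum l -> l k != 0 ->
  exists (c : R) q i j, [/\ c != 0, i != j, 1 <= q <= 2
    & l = fun m => c * slope_fun q i j m].
Proof.
rewrite /zero_sum sum_ord3 => l0 lk.
have sorted3 (i j m : 'I_3) : uniq [:: i; j; m] -> l m <= l j <= l i ->
    exists (c : R) q i j, [/\ c != 0, i != j, 1 <= q <= 2
      & l = fun m => c * slope_fun q i j m].
  move=> u /andP[mj ji].
  have e : l i + l j + l m = 0.
    rewrite -l0; move: u; move: (i) (j) (m).
    by apply: ord3_ind; apply: ord3_ind; apply: ord3_ind => //= _; ring.
  have : l k = l i \/ l k = l j \/ l k = l m.
    move: u; move: (i) (j) (m) (k).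
    by do 4!(apply: ord3_ind => //=); move=> _; auto.
  move=> lkE; case: (lerP (l j) 0) => lj.
  - have lm : l m < 0.
      rewrite lt_neqAle (le_trans mj lj) andbT; apply: contra_neq lk.
      by case: lkE => [|[|]] -> lm0; lra.
    exists (- l m), (- l i / l m), i, m; split.
    + by rewrite oppr_eq0 ltr0_neq0.
    + by move: u; rewrite /= !inE negb_or => /andP[/andP[]].
    + by rewrite -mulrNN -invrN opprK ler_pdivlMr ?ler_pdivrMr; lra.
    + apply: (slope_funE (m := j)); last by rewrite ltr0_neq0.
        move: u; rewrite /= !inE !negb_or !andbT [m == j]eq_sym.
        by move=> /andP[/andP[-> ->] ->].
      by lra.
  - have li : 0 < l i by lra.
    exists (- l i), (- l m / l i), m, i; split.
    + by rewrite oppr_eq0 lt0r_neq0.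
    + by move: u; rewrite /= !inE negb_or [m == i]eq_sym => /andP[/andP[]].
    + by rewrite ler_pdivlMr ?ler_pdivrMr //; lra.
    + apply: (slope_funE (m := j)); last by rewrite lt0r_neq0.
        move: u; rewrite /= !inE !negb_or !andbT [m == i]eq_sym [m == j]eq_sym.
        by move=> /andP[/andP[-> ->] ->].
      by lra.
have [l01|l10] := lerP (l 0) (l 1); have [l02|l20] := lerP (l 0) (l 2);
  have [l12|l21] := lerP (l 1) (l 2).
- by apply: (sorted3 2 1 0) => //; apply/andP; split; lra.
- by apply: (sorted3 1 2 0) => //; apply/andP; split; lra.
- by apply: (sorted3 2 1 0) => //; apply/andP; split; lra.
- by apply: (sorted3 1 0 2) => //; apply/andP; split; lra.
- by apply: (sorted3 2 0 1) => //; apply/andP; split; lra.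
- by apply: (sorted3 0 1 2) => //; apply/andP; split; lra.
- by apply: (sorted3 0 2 1) => //; apply/andP; split; lra.
- by apply: (sorted3 0 1 2) => //; apply/andP; split; lra.
Qed.

End Directions.

(** * Pointwise derivatives at vertices *)

Section Limits.
Context {R : realType}.
Implicit Types (l s t : 'I_3 -> R) (i j : 'I_3) (w : seq 'I_3).

(** The derivative at a vertex where the normal derivative is [l]. *)
Definition vertex_value l t : R := dot l t ^+ 2 / dot l l.

Lemma vertex_value_scale (c : R) l t : c != 0 ->
  vertex_value (fun j => c * l j) t = vertex_value l t.
Proof.
move=> c0; rewrite /vertex_value.
have -> : dot (fun j => c * l j) t = c * dot l t by rewrite !dotE; ring.
have -> : dot (fun j => c * l j) (fun j => c * l j) = c ^+ 2 * dot l l.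
  by rewrite !dotE; ring.
by rewrite exprMn -mulf_div divff ?mul1r // expf_neq0.
Qed.

Lemma dual_word_cat w w' l :
  dual_word (w ++ w') l = dual_word w (dual_word w' l).
Proof. exact: foldr_cat. Qed.

Lemma dual_word_nseq_flux n i :
  dual_word (nseq n i) (flux_fun i) = fun j => 3 ^+ n * flux_fun i j :> R.
Proof.
elim: n => [|n /= ->]; first by apply/funext => j; rewrite mul1r.
rewrite dual_ext_scale dual_ext_flux.
by apply/funext => j; rewrite exprSr mulrA.
Qed.

Lemma dual_word_nseq_skew n i :
  dual_word (nseq n i) (skew_fun i) = skew_fun i :> ('I_3 -> R).
Proof. by elim: n => //= n ->; exact: dual_ext_skew. Qed.

(** Along the cells shrinking to the [i]-th corner of the cell [w] the normal
    derivative at that corner gains a factor 3 per level over the other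
    component, so it alone survives in the limit. *)
Lemma cell_ratio_cvg w i t :
  (cell_mass (w ++ nseq n i) t / kusuoka_mass (w ++ nseq n i) : R)
    @[n --> \oo] --> vertex_value (dual_word w (flux_fun i)) t.
Proof.
pose a : 'I_3 -> R := dual_word w (flux_fun i).
pose b : 'I_3 -> R := dual_word w (skew_fun i).
have [j aj] := @dual_word_flux_neq0 R w i.
have aa : 0 < dot a a := dot_self_gt0 aj.
pose z : R^nat := fun n => (9^-1) ^+ n.
pose f (x y : R) n := x + 3 * y * z n.
have -> : (fun n => cell_mass (w ++ nseq n i) t / kusuoka_mass (w ++ nseq n i)) =
    (fun n => f (dot a t ^+ 2) (dot b t ^+ 2) n / f (dot a a) (dot b b) n).
  apply/funext => n; rewrite (cell_massE i) (kusuoka_massE i) !dual_word_cat.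
  rewrite dual_word_nseq_flux dual_word_nseq_skew dual_word_scale -/a -/b.
  have E9 : (3 ^+ n : R) ^+ 2 = 9 ^+ n.
    by rewrite -exprM mulnC exprM; congr (_ ^+ n); ring.
  have -> : dot (fun j => 3 ^+ n * a j) t = 3 ^+ n * dot a t by rewrite !dotE; ring.
  have -> : dot (fun j => 3 ^+ n * a j) (fun j => 3 ^+ n * a j) =
     9 ^+ n * dot a a by rewrite -E9 !dotE; ring.
  rewrite -mulf_div divff ?mul1r; last by rewrite !expf_neq0 // invr_eq0 pnatr_eq0.
  rewrite /f /z exprVn exprMn E9.
  have n9 : (9 ^+ n : R) != 0 by rewrite expf_neq0 // pnatr_eq0.
  have n9' : (0 : R) < 9 ^+ n by rewrite exprn_gt0.
  have bb := dot_self_ge0 b.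
  by field; rewrite n9 /= lt0r_neq0 //; nra.
have z0 : z @ \oo --> (0 : R).
  by apply: cvg_expr; rewrite ger0_norm ?invr_ge0 // invf_lt1 // ltr1n.
have fcvg x y : f x y @ \oo --> x.
  rewrite -[X in _ --> X]addr0 -[X in _ + X](mulr0 (3 * y)).
  by rewrite /f; apply: cvgD; [exact: cvg_cst|apply: cvgM => //; exact: cvg_cst].
by apply: cvgM; [exact: fcvg|apply: cvgV; [rewrite lt0r_neq0|exact: fcvg]].
Qed.

Definition vec_cvg (L : nat -> 'I_3 -> R) l :=
  forall j, L n j @[n --> \oo] --> l j.

Lemma vec_cvg_dual_word w L l :
  vec_cvg L l -> vec_cvg (fun n => dual_word w (L n)) (dual_word w l).
Proof.
move=> Ll; elim: w => //= i w IH j; rewrite /dual_ext.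
apply: cvgD; first by apply: cvgB; exact: IH.
by do 2!(apply: cvgM; [exact: cvg_cst|]); exact: IH.
Qed.

Lemma vec_cvg_dot (L M : nat -> 'I_3 -> R) l m : vec_cvg L l -> vec_cvg M m ->
  dot (L n) (M n) @[n --> \oo] --> dot l m.
Proof.
move=> Ll Mm; under [X in X @ _]eq_fun do rewrite dotE; rewrite dotE.
by do 2?apply: cvgD; apply: cvgM; do ?[exact: Ll|exact: Mm].
Qed.

Lemma vertex_value_cvg L l k t : vec_cvg L l -> l k != 0 ->
  vertex_value (L n) t @[n --> \oo] --> vertex_value l t.
Proof.
move=> Ll lk; have ll := dot_self_gt0 lk.
apply: cvgM; last by apply: cvgV; [rewrite lt0r_neq0|exact: vec_cvg_dot].
have Lt : dot (L n) t @[n --> \oo] --> dot l t.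
  by apply: vec_cvg_dot => // j; exact: cvg_cst.
by rewrite expr2; under [X in X @ _]eq_fun do rewrite expr2; exact: cvgM.
Qed.

Lemma normal_dir_dense l k : zero_sum l -> l k != 0 ->
  exists2 L, vec_cvg L l & forall n, normal_dir (L n).
Proof.
move=> l0 lk.
have [c [q [i [j [cn0 ij q12 ->]]]]] := slope_fun_normal_form l0 lk.
have /choice[f fP] n : exists q', `|q - q'| <= (3 / 4) ^+ n /\
    normal_dir (slope_fun q' i j).
  by have [q' qq' [_ ?]] := slope_dense n ij q12; exists q'.
exists (fun n m => c * slope_fun (f n) i j m); last first.
  by move=> n; have [_ ?] := fP n; exact: normal_dir_scale.
have fq : f @ \oo --> q.
  have ratio_ge0 : (0 : R) <= 3 / 4 by lra.
  have ratio_lt1 : (3 / 4 : R) < 1 by lra.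
  have /cvgrPdist_le z0 : ((3 / 4 : R) ^+ n) @[n --> \oo] --> (0 : R).
    by apply: cvg_expr; rewrite ger0_norm.
  apply/cvgrPdist_le => e /z0; apply: filterS => n; rewrite sub0r normrN.
  rewrite ger0_norm ?exprn_ge0 //.
  by apply: le_trans; have [] := fP n.
move=> m; apply: cvgM; first exact: cvg_cst.
rewrite /slope_fun; case: (m == i) => //; case: (m == j).
  exact: cvg_cst.
by apply: cvgB => //; exact: cvg_cst.
Qed.

(** Restriction to the cell [w] acts invertibly on functionals, so density of the
    normal directions in the whole gasket gives it among the vertices of [w]. *)
Lemma vertex_value_dense w l k t : zero_sum l -> l k != 0 ->
  exists W : nat -> seq 'I_3 * 'I_3,
    vertex_value (dual_word (w ++ (W n).1) (flux_fun (W n).2)) t @[n --> \oo]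
      --> vertex_value l t.
Proof.
move=> l0 lk; have [s s0 sl] := dual_word_onto w l0.
have [j sj] : exists j, s j != 0.
  apply: contrapT => /forallNP s0'.
  have sE : s = fun j => 0 * s j.
    by apply/funext => j; rewrite mul0r; apply/eqP/negPn/negP/s0'.
  by move: lk; rewrite -sl sE dual_word_scale mul0r eqxx.
have [L Ls LD] := normal_dir_dense s0 sj.
have /choice[W WP] n : exists v : seq 'I_3 * 'I_3,
    vertex_value (dual_word (w ++ v.1) (flux_fun v.2)) t =
    vertex_value (dual_word w (L n)) t.
  have [c [v [i [c0 ->]]]] := LD n; exists (v, i) => /=.
  by rewrite dual_word_scale vertex_value_scale // dual_word_cat.
exists W; under [X in X @ _]eq_fun do rewrite WP.
by apply: vertex_value_cvg lk; rewrite -sl; exact: vec_cvg_dual_word.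
Qed.

End Limits.

(** * Geometry of the gasket *)

Section Geometry.
Context {R : realType}.
Variables (q : 'I_3 -> R * R) (K : set (R * R)).
Implicit Types (x y z : R * R) (i j : 'I_3) (w u : seq 'I_3).

(** Barycentric coordinates with respect to the corners, given by the properties
    that the combinatorics of the cells rests on. *)
Definition barycentric (b : 'I_3 -> R * R -> R) : Prop :=
  [/\ forall i j x, b j (Fmap q i x) = (b j x + (i == j)%:R) / 2,
      forall i j, b j (q i) = (i == j)%:R,
      forall x, \sum_(j < 3) b j x = 1,
      forall x y, (forall j, b j x = b j y) -> x = y
    & forall j, continuous (b j)].

Lemma equilateral_barycentric : equilateral q -> exists b, barycentric b.
Proof.
move=> [s s0 qs].
have sq i j : i != j ->
    ((q i).1 - (q j).1) ^+ 2 + ((q i).2 - (q j).2) ^+ 2 = s ^+ 2.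
  by move=> /qs <-; rewrite sqr_sqrtr // addr_ge0 ?sqr_ge0.
pose cross x y : R := x.1 * y.2 - x.2 * y.1.
pose D := cross (q 1 - q 0) (q 2 - q 0).
have D0 : D != 0.
  have DD : D ^+ 2 = 3 / 4 * s ^+ 4.
    (* Lagrange's identity for the two sides issuing from the first corner *)
    have lagrange (a b c d : R) : (a * d - b * c) ^+ 2 =
        (a ^+ 2 + b ^+ 2) * (c ^+ 2 + d ^+ 2) -
        ((a ^+ 2 + b ^+ 2 + (c ^+ 2 + d ^+ 2)
          - ((a - c) ^+ 2 + (b - d) ^+ 2)) / 2) ^+ 2 by field.
    have telescope (a b c : R) : a - c - (b - c) = a - b by ring.
    by rewrite /D /cross /= lagrange !telescope !sq //; field.
  have : D ^+ 2 != 0 by rewrite DD lt0r_neq0 // mulr_gt0 ?exprn_gt0 //; lra.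
  by rewrite sqrf_eq0.
pose o1 j := if j == 0 then q 1 else if j == 1 then q 2 else q 0.
pose o2 j := if j == 0 then q 2 else if j == 1 then q 0 else q 1.
exists (fun j x => cross (o1 j - x) (o2 j - x) / D); split.
- move=> i j x; rewrite /Fmap /cross /o1 /o2 /=.
  by move: i j; apply: ord3_ind; apply: ord3_ind => /=; rewrite /D /cross /=; field.
- move=> i j; rewrite /cross /o1 /o2 /=.
  by move: i j; apply: ord3_ind; apply: ord3_ind => /=; rewrite /D /cross /=; field.
- by move=> x; rewrite sum_ord3 /cross /o1 /o2 /=; rewrite /D /cross /=; field.
- move=> x y bxy.
  have xE z : z = (cross (q 1 - z) (q 2 - z) / D * (q 0).1
      + cross (q 2 - z) (q 0 - z) / D * (q 1).1
      + cross (q 0 - z) (q 1 - z) / D * (q 2).1,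
      cross (q 1 - z) (q 2 - z) / D * (q 0).2
      + cross (q 2 - z) (q 0 - z) / D * (q 1).2
      + cross (q 0 - z) (q 1 - z) / D * (q 2).2).
    by case: z => z1 z2; congr (_, _); rewrite /D /cross /=; field.
  have := bxy 0; have := bxy 1; have := bxy 2; rewrite /o1 /o2 /= => e2 e1 e0.
  by rewrite (xE x) (xE y) e0 e1 e2.
- move=> j x; apply: cvgM; last exact: cvg_cst.
  have c1 : continuous (fun y : R * R => y.1) by move=> ?; exact: cvg_fst.
  have c2 : continuous (fun y : R * R => y.2) by move=> ?; exact: cvg_snd.
  rewrite /cross /=; apply: cvgB; apply: cvgM; apply: cvgB;
    do ?[exact: cvg_cst|exact: c1|exact: c2].
Qed.

Lemma Fmap_corner i : Fmap q i (q i) = q i.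
Proof. by rewrite /Fmap; case: (q i) => a b /=; congr (_, _); field. Qed.

Lemma Fword_cat w u x : Fword q (w ++ u) x = Fword q w (Fword q u x).
Proof. by elim: w => //= i w ->. Qed.

Lemma Fword_corner n i : Fword q (nseq n i) (q i) = q i.
Proof. by elim: n => //= n ->; exact: Fmap_corner. Qed.

Lemma Fmap_inj i x y : Fmap q i x = Fmap q i y -> x = y.
Proof. by case: x y => [a b] [c d] [] e1 e2; congr (_, _); lra. Qed.

Lemma Fword_dist w x y :
  (Fword q w x).1 - (Fword q w y).1 = 2^-1 ^+ size w * (x.1 - y.1) /\
  (Fword q w x).2 - (Fword q w y).2 = 2^-1 ^+ size w * (x.2 - y.2).
Proof.
elim: w => [|i w [IH1 IH2]] /=; first by rewrite !mul1r.
by split; rewrite exprS -mulrA -?IH1 -?IH2; field.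
Qed.

Hypothesis gasketK : is_gasket q K.

Lemma gasket_Fword w x : K x -> K (Fword q w x).
Proof.
move=> Kx; have [_ _ KE] := gasketK.
by elim: w => //= i w IH; rewrite KE; exists i.
Qed.

Lemma gasket_split x : K x -> exists i y, K y /\ x = Fmap q i y.
Proof. by have [_ _ {1}->] := gasketK; move=> [i _ [y Ky <-]]; exists i, y. Qed.

Lemma gasket_closed : closed K.
Proof. by have [_ cK _] := gasketK; exact: compact_closed. Qed.

Lemma gasket_bounded : exists M : R, forall x, K x -> `|x.1| <= M /\ `|x.2| <= M.
Proof.
have [_ /compact_bounded[M [_ KM]] _] := gasketK.
exists (M + 1) => x Kx; have : `|x| <= M + 1 by apply: KM => //; lra.
by rewrite prod_normE ge_max => /andP[].
Qed.

Lemma cvg_coord (p : nat -> R * R) x :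
  (p n).1 @[n --> \oo] --> x.1 -> (p n).2 @[n --> \oo] --> x.2 ->
  p @ \oo --> x.
Proof.
move=> p1 p2; rewrite [x]surjective_pairing.
have -> : p = fun n => ((p n).1, (p n).2).
  by apply/funext => n; rewrite -surjective_pairing.
exact: cvg_pair p1 p2.
Qed.

Lemma Fword_cvg (W : nat -> seq 'I_3) (p : nat -> R * R) x y :
    (forall n, size (W n) = n) -> (forall n, K (p n)) ->
    (forall n, Fword q (W n) (p n) = x) ->
  Fword q (W n) y @[n --> \oo] --> x.
Proof.
move=> sW Kp Wp; have [M KM] := gasket_bounded.
have cvg0 (f g : nat -> R) (l a : R) : (forall n, l - f n = 2^-1 ^+ n * (g n - a)) ->
    (forall n, `|g n| <= M) -> f @ \oo --> l.
  move=> fE gM.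
  have /cvgrPdist_le z0 : ((2^-1 : R) ^+ n * (M + `|a|)) @[n --> \oo] --> (0 : R).
    rewrite -[X in _ --> X](mul0r (M + `|a|)); apply: cvgM; last exact: cvg_cst.
    by apply: cvg_expr; rewrite ger0_norm ?invr_ge0 // invf_lt1 // ltr1n.
  apply/cvgrPdist_le => e /z0; apply: filterS => n.
  rewrite sub0r normrN normrM; rewrite fE normrM; apply: le_trans.
  rewrite ler_wpM2l // (le_trans (ler_normB _ _)) //.
  by rewrite (le_trans _ (ler_norm _)) // lerD.
apply: cvg_coord.
- apply: (cvg0 _ (fun n => (p n).1) _ y.1) => n; last by have [] := KM _ (Kp n).
  by rewrite -{1}(Wp n) (Fword_dist _ _ _).1 sW.
- apply: (cvg0 _ (fun n => (p n).2) _ y.2) => n; last by have [] := KM _ (Kp n).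
  by rewrite -{1}(Wp n) (Fword_dist _ _ _).2 sW.
Qed.

Lemma gasket_corner i : K (q i).
Proof.
have [[x Kx] _ _] := gasketK.
suff : Fword q (nseq n i) x @[n --> \oo] --> q i.
  apply: (closed_cvg K) => //; first exact: gasket_closed.
  by apply: nearW => n; exact: gasket_Fword.
have half (f : nat -> R) (l a : R) :
    (forall n, f n - l = 2^-1 ^+ n * a) -> f @ \oo --> l.
  move=> fE; rewrite -[X in _ --> X]addr0 -(mul0r a).
  have -> : f = fun n => l + 2^-1 ^+ n * a.
    by apply/funext => n; rewrite -fE addrC subrK.
  apply: cvgD; first exact: cvg_cst.
  apply: cvgM; last exact: cvg_cst.
  by apply: cvg_expr; rewrite ger0_norm ?invr_ge0 // invf_lt1 // ltr1n.
by apply: cvg_coord; [apply: (half _ _ (x.1 - (q i).1))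
  |apply: (half _ _ (x.2 - (q i).2))] => n;
  have [d1 d2] := Fword_dist (nseq n i) x (q i);
  rewrite size_nseq Fword_corner in d1 d2.
Qed.

(** The letters are obtained one by one from the self-similarity of the gasket. *)
Lemma address x : K x -> exists (W : nat -> seq 'I_3) (p : nat -> R * R),
  forall n, [/\ size (W n) = n, K (p n), Fword q (W n) (p n) = x
    & exists i, W n.+1 = rcons (W n) i].
Proof.
move=> Kx.
have /choice[s sP] y : exists r : 'I_3 * (R * R),
    K y -> K r.2 /\ y = Fmap q r.1 r.2.
  have [/gasket_split[i [z [Kz yz]]]|nK] := pselect (K y).
    by exists (i, z).
  by exists (0, y).
pose p n := iter n (fun y => (s y).2) x.
pose W n := [seq (s (p k)).1 | k <- iota 0 n].
have Kp n : K (p n) by elim: n => //= n /sP[].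
have WS n : W n.+1 = rcons (W n) (s (p n)).1.
  by rewrite /W -(addn1 n) iotaD map_cat cats1.
exists W, p => n; split => //; first by rewrite size_map size_iota.
  elim: n => // n <-; rewrite WS -cats1 Fword_cat /=.
  by congr Fword; have [_ /esym] := sP _ (Kp n).
by exists (s (p n)).1.
Qed.

Lemma cell_seq_exists x : K x -> exists C, cell_seq q K x C.
Proof.
move=> /address[W [p Wp]]; exists (fun n => Fword q (W n) @` K) => n.
have [sW Kp Wx [i WS]] := Wp n; split; [by exists (W n)| |by exists (p n)].
rewrite WS -cats1 => _ [y Ky <-]; rewrite Fword_cat.
by exists (Fword q [:: i] y) => //; exact: gasket_Fword.
Qed.

(** The cells of level [n] have diameter of order [2^-n], so vertices are dense. *)
Lemma eq_on_vertices (h : R * R -> R) (c : R) :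
    {within K, continuous h} -> (forall w, h (Fword q w (q 0)) = c) ->
  forall x, K x -> h x = c.
Proof.
move=> /subspace_continuousP hK hc x Kx; have [W [p Wp]] := address Kx.
have Wx : Fword q (W n) (q 0) @[n --> \oo] --> x.
  by apply: (@Fword_cvg W p) => n; have [] := Wp n.
have : h (Fword q (W n) (q 0)) @[n --> \oo] --> h x.
  apply: cvg_comp (hK x Kx) => A xA.
  have : \forall n \near \oo, K (Fword q (W n) (q 0)) -> A (Fword q (W n) (q 0)).
    exact: Wx xA.
  by apply: filterS => n; apply; apply: gasket_Fword; exact: gasket_corner.
under [X in X @ _]eq_fun do rewrite hc.
move=> hx; exact: (@cvg_unique _ (@Rhausdorff R) _ _ _ _ hx (cvg_cst c)).
Qed.

Section Barycentric.
Variable b : 'I_3 -> R * R -> R.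
Hypothesis bP : barycentric b.

(** The minimum of a coordinate over the gasket is at least half of itself. *)
Lemma barycentric_ge0 j x : K x -> 0 <= b j x.
Proof.
have [K0 cK _] := gasketK; have [bF _ _ _ bc] := bP.
have [y Ky ymin] : exists2 y, y \in K & forall t, t \in K -> b j y <= b j t.
  by apply: compact_EVT_min => //; apply: continuous_subspaceT; exact: bc.
suff b0 : 0 <= b j y by move=> Kx; apply: le_trans b0 (ymin _ _); exact/mem_set.
have [i [z [Kz yz]]] := gasket_split (set_mem Ky).
have := ymin z (mem_set Kz); rewrite yz bF.
have : (0 : R) <= (i == j)%:R by [].
by lra.
Qed.

(** With nonnegative coordinates of sum 1, a coordinate 1 forces the others
    to vanish. *)
Lemma corner_of_barycentric i x : K x -> 1 <= b i x -> x = q i.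
Proof.
have [_ bq b1 binj _] := bP => Kx bi; apply: binj.
have := barycentric_ge0 0 Kx; have := barycentric_ge0 1 Kx.
have := barycentric_ge0 2 Kx; have := b1 x; rewrite sum_ord3 => e p2 p1 p0.
move=> j; rewrite bq; move: i j bi; apply: ord3_ind; apply: ord3_ind => /= bi; lra.
Qed.

Lemma corner_inj i j : q i = q j -> i = j.
Proof.
have [_ bq _ _ _] := bP => /(congr1 (b i)); rewrite !bq eqxx [j == i]eq_sym.
by case: eqP => // _ /eqP; rewrite oner_eq0.
Qed.

(** A common point of two subcells has coordinates at least 1/2 at both corners,
    hence is the midpoint of the edge joining them. *)
Lemma Fmap_meet i j x y : i != j -> K x -> K y -> Fmap q i x = Fmap q j y ->
  x = q j /\ y = q i.
Proof.
have [bF _ _ _ _] := bP => ij Kx Ky e.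
have ji : (j == i) = false by rewrite eq_sym (negPf ij).
have ei := congr1 (b i) e; have ej := congr1 (b j) e.
rewrite !bF !eqxx ji (negPf ij) /= in ei ej.
have := barycentric_ge0 i Kx; have := barycentric_ge0 j Ky => yj xi.
by split; apply: corner_of_barycentric => //; lra.
Qed.

Lemma corner_in_cell u z j : K z -> Fword q u z = q j ->
  u = nseq (size u) j /\ z = q j.
Proof.
move=> Kz; elim: u => //= i u IH; rewrite -{1}(Fmap_corner j) => e.
have [ij|ij] := eqVneq i j.
  by move: e; rewrite ij => /Fmap_inj/IH[<- ->].
have [_ qji] := Fmap_meet ij (gasket_Fword u Kz) (gasket_corner j) e.
by move: ij; rewrite (corner_inj qji) eqxx.
Qed.

Lemma corner_flux w i j : Fword q w (q i) = q j ->
  dual_word w (flux_fun i) = fun k => 3 ^+ size w * flux_fun j k :> R.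
Proof.
move=> e; have [wE /corner_inj ->] := corner_in_cell (gasket_corner i) e.
by rewrite {1}wE dual_word_nseq_flux.
Qed.

(** The normal derivative at a vertex does not depend, up to a factor, on the
    cell in which it is computed: either the cells lie in the same subcell, or
    the vertex is the common point of two subcells. *)
Lemma vertex_flux u j w i : Fword q u (q j) = Fword q w (q i) ->
  exists2 c : R, c != 0 &
    dual_word u (flux_fun j) = fun k => c * dual_word w (flux_fun i) k.
Proof.
have pow3 n : (3 ^+ n : R) != 0 by rewrite expf_neq0 // pnatr_eq0.
elim: u w => [|a u IH] [|d w] /= e.
- exists 1; first exact: oner_neq0.
  by rewrite (corner_inj e); apply/funext => k; rewrite mul1r.
- exists (3 ^+ size (d :: w))^-1; first by rewrite invr_eq0.
  have := corner_flux (w := d :: w) (esym e) => /= ->.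
  by apply/funext => k; rewrite mulKf.
- exists (3 ^+ size (a :: u)); first by [].
  exact: (corner_flux (w := a :: u) e).
have [ad|ad] := eqVneq a d.
  rewrite -ad in e *; have [c c0 ->] := IH w (Fmap_inj e).
  by exists c => //; exact: dual_ext_scale.
have Ku : K (Fword q u (q j)) := gasket_Fword u (gasket_corner j).
have Kw : K (Fword q w (q i)) := gasket_Fword w (gasket_corner i).
have [/corner_flux -> /corner_flux ->] := Fmap_meet ad Ku Kw e.
exists (- 3 ^+ size u / 3 ^+ size w).
  by rewrite mulf_neq0 ?oppr_eq0 ?invr_eq0.
rewrite !dual_ext_scale dual_ext_flux_swap //; apply/funext => k.
by rewrite [RHS]mulrA divfK // mulN1r mulrN mulNr.
Qed.

Lemma vertex_in_cell u z w i : size u = size w -> K z ->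
  Fword q u z = Fword q w (q i) -> exists j, z = q j.
Proof.
move=> + Kz; elim: u w => [|a u IH] [|d w] //= => [_ ->|[suw] e]; first by exists i.
have [ad|ad] := eqVneq a d; first by rewrite ad in e; exact: IH suw (Fmap_inj e).
have Kw : K (Fword q w (q i)) := gasket_Fword w (gasket_corner i).
have [/(corner_in_cell Kz)[_ ->] _] := Fmap_meet ad (gasket_Fword u Kz) Kw e.
by exists d.
Qed.

(** All small cells containing a vertex shrink to it at one of their own
    corners. *)
Lemma cell_at_vertex u w i : (size w <= size u)%N ->
    (Fword q u @` K) (Fword q w (q i)) ->
  exists j, u = take (size w) u ++ nseq (size u - size w) j /\
    Fword q (take (size w) u) (q j) = Fword q w (q i).
Proof.
move=> wu [z Kz]; rewrite -{1}(cat_take_drop (size w) u) Fword_cat => e.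
have [j zj] := vertex_in_cell (size_takel wu) (gasket_Fword _ Kz) e.
exists j; have [dE _] := corner_in_cell Kz zj; split; last by rewrite -zj.
by rewrite -size_drop -dE cat_take_drop.
Qed.

End Barycentric.
End Geometry.

(** * Borel sets of the plane *)

(** Rational rectangles form a countable base of the plane. *)
Lemma open_measurable_plane (R : realType) (U : set (R * R)) :
  open U -> measurable U.
Proof.
move=> oU.
pose box (v : (rat * rat) * (rat * rat)) : set (R * R) :=
  `]ratr v.1.1, ratr v.1.2[%classic `*` `]ratr v.2.1, ratr v.2.2[%classic.
pose F v := if `[< box v `<=` U >] then box v else set0.
have -> : U = \bigcup_v F v.
  apply/seteqP; split=> [x Ux|x [v _]]; last first.
    by rewrite /F; case: asboolP => // vU; exact: vU.
  have [e /= e0 eU] : nbhs_ball x U.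
    by rewrite nbhs_ballE; exact: open_nbhs_nbhs.
  have below (y : R) : y - e < y by lra.
  have above (y : R) : y < y + e by lra.
  have [a1] := rat_in_itvoo (below x.1); have [a2] := rat_in_itvoo (above x.1).
  have [b1] := rat_in_itvoo (below x.2); have [b2] := rat_in_itvoo (above x.2).
  rewrite !in_itv /= => /andP[b2l b2r] /andP[b1l b1r] /andP[a2l a2r] /andP[a1l a1r].
  exists ((a1, a2), (b1, b2)) => //; rewrite /F; case: asboolP => [_|[]].
    by split; rewrite /= in_itv /= ?a1r ?a2l ?b1r.
  move=> y [] /=; rewrite !in_itv /= => /andP[yl yr] /andP[yl' yr'].
  by apply: eU; split; rewrite /= /ball /= ltr_norml; apply/andP; split; lra.
apply: countable_bigcupT_measurable => [|v]; first exact: countableP.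
rewrite /F; case: asboolP => _; last exact: measurable0.
by apply: measurableX; exact: measurable_itv.
Qed.

Lemma closed_measurable_plane (R : realType) (A : set (R * R)) :
  closed A -> measurable A.
Proof.
move=> cA; rewrite -(setCK A); apply: measurableC.
by apply: open_measurable_plane; rewrite openC.
Qed.

(** * Energies of harmonic functions *)

Section Energy.
Context {R : realType}.
Variable q : 'I_3 -> R * R.
Implicit Types (u v : R * R -> R) (i j : 'I_3) (w : seq 'I_3).

Definition trace u : 'I_3 -> R := fun i => u (q i).

Definition constant_energy u :=
  forall m n, energy_level q m u u = energy_level q n u u.

Lemma big_tuple_cons (T : finType) (F : seq T -> R) m :
  \sum_(w : m.+1.-tuple T) F w = \sum_(i : T) \sum_(w : m.-tuple T) F (i :: w).
Proof.
rewrite pair_bigA /=.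
rewrite (reindex (fun p : T * m.-tuple T => [tuple of p.1 :: p.2])) //=.
exists (fun w : m.+1.-tuple T => (thead w, [tuple of behead w])).
  by move=> [i w] _ /=; congr pair; exact: val_inj.
by move=> w _; rewrite [w in RHS]tuple_eta.
Qed.

Lemma energy_level0 u v : energy_level q 0 u v = edge_form (trace u) (trace v).
Proof.
rewrite /energy_level mul1r (big_pred1 [tuple]) //.
by move=> w; apply/esym/eqP; exact: tuple0.
Qed.

Lemma energy_levelS m u v : energy_level q m.+1 u v =
  5 / 3 * \sum_(i < 3) energy_level q m (u \o Fmap q i) (v \o Fmap q i).
Proof.
rewrite /energy_level -mulr_sumr mulrA -exprS; congr (_ * _).
exact: (big_tuple_cons (fun w => \sum_(i < 3) \sum_(j < 3 | (i < j)%N)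
  (u (Fword q w (q i)) - u (Fword q w (q j))) *
  (v (Fword q w (q i)) - v (Fword q w (q j))))).
Qed.

(** The midpoints are shared by two subcells, so one refinement of the energy is
    an instance of [edge_form_ext_min]. *)
Lemma energy_level01 u :
  energy_level q 0 u u <= energy_level q 1 u u /\
  (energy_level q 0 u u = energy_level q 1 u u ->
   forall i, trace (u \o Fmap q i) = harm_ext i (trace u)).
Proof.
have diag i : u (Fmap q i (q i)) = trace u i by rewrite Fmap_corner.
have swap i j : u (Fmap q i (q j)) = u (Fmap q j (q i)).
  by rewrite /Fmap; congr (u (_, _)); rewrite addrC.
have [le_ext eq_ext] :=
  edge_form_ext_min (s := fun i j => u (Fmap q i (q j))) diag swap.
rewrite energy_levelS energy_level0; under eq_bigr do rewrite energy_level0.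
split => // /eq_ext e i; apply/funext => j; exact: e.
Qed.

Lemma energy_level_nondecreasing m u :
  energy_level q m u u <= energy_level q m.+1 u u.
Proof.
elim: m u => [|m IH] u; first by have [] := energy_level01 u.
rewrite [leRHS]energy_levelS energy_levelS; apply: ler_wpM2l; first by lra.
by apply: ler_sum => i _; exact: IH.
Qed.

(** The level energies of [u] are, up to the factor 5/3, sums of those of its
    restrictions to the three subcells, each of which is nondecreasing. *)
Lemma constant_energy_sub u i :
  constant_energy u -> constant_energy (u \o Fmap q i).
Proof.
move=> cu.
suff step m : energy_level q m (u \o Fmap q i) (u \o Fmap q i) =
    energy_level q m.+1 (u \o Fmap q i) (u \o Fmap q i).
  have all0 m : energy_level q m (u \o Fmap q i) (u \o Fmap q i) =
      energy_level q 0 (u \o Fmap q i) (u \o Fmap q i).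
    by elim: m => // m <-.
  by move=> m n; rewrite !all0.
have : \sum_(j < 3) (energy_level q m.+1 (u \o Fmap q j) (u \o Fmap q j)
         - energy_level q m (u \o Fmap q j) (u \o Fmap q j)) = 0.
  have e := cu m.+2 m.+1; rewrite [LHS]energy_levelS energy_levelS in e.
  have c0 : (5 / 3 : R) != 0 by rewrite lt0r_neq0 //; lra.
  by rewrite sumrB (mulfI c0 e) subrr.
move/eqP; rewrite psumr_eq0 => [/allP/(_ i)|j _]; last first.
  by rewrite subr_ge0 energy_level_nondecreasing.
by rewrite mem_index_enum /= => /(_ isT); rewrite subr_eq0 => /eqP.
Qed.

Lemma trace_Fword w u : constant_energy u ->
  constant_energy (u \o Fword q w) /\
  trace (u \o Fword q w) = harm_word w (trace u).
Proof.
elim: w u => [//|i w IH] u cu.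
have [c e] := IH _ (constant_energy_sub i cu); split; first exact: c.
rewrite [LHS]e /=; congr (harm_word w _).
by have [_ /(_ (cu 0%N 1%N))] := energy_level01 u.
Qed.

Lemma energy_edge_form u v : constant_energy u -> constant_energy v ->
  energy q u v = edge_form (trace u) (trace v).
Proof.
move=> cu cv; rewrite /energy.
have lvl m : energy_level q m u v = edge_form (trace u) (trace v).
  elim: m u v cu cv => [|m IH] u v cu cv; first exact: energy_level0.
  rewrite energy_levelS -edge_form_harm_ext; congr (_ * _).
  apply: eq_bigr => i _.
  rewrite IH; [|exact: constant_energy_sub|exact: constant_energy_sub].
  have [_ /(_ (cu 0%N 1%N) i) ->] := energy_level01 u.
  by have [_ /(_ (cv 0%N 1%N) i) ->] := energy_level01 v.
by under [X in lim (X @ _)]eq_fun do rewrite lvl; rewrite lim_cst.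
Qed.

Lemma energy_measure_cell K u mu w : constant_energy u ->
  is_energy_measure q K u mu ->
  mu (Fword q w @` K) = ((5 / 3) ^+ size w * cell_mass w (trace u))%:E.
Proof.
move=> cu [_ ->]; have [c e] := trace_Fword w cu.
by rewrite energy_edge_form // e.
Qed.

Lemma harm_word_const w (c : R) : harm_word w (fun=> c) = fun=> c.
Proof.
elim: w => // i w IH; have ext : harm_ext i (fun=> c) = fun=> c.
  by apply/funext => j; rewrite /harm_ext sum_ord3; case: ifP => // _; field.
by rewrite -[RHS]IH -[in RHS]ext.
Qed.

(** Equal corner values propagate to all vertices, then by continuity to the
    gasket. *)
Lemma constant_of_edge_form0 K h : is_gasket q K -> harmonic_on q K h ->
  edge_form (trace h) (trace h) = 0 -> exists c, forall x, K x -> h x = c.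
Proof.
move=> gK [hK ch] h0; exists (h (q 0)).
have tr : trace h = fun=> h (q 0).
  apply/funext; move: h0; rewrite edge_formE -!expr2 => /eqP.
  rewrite !paddr_eq0 ?addr_ge0 ?sqr_ge0 // !sqrf_eq0 !subr_eq0.
  move=> /andP[/andP[/eqP h01 /eqP h02] _].
  by apply: ord3_ind; rewrite -?h01 -?h02.
apply: (eq_on_vertices gK hK) => w.
have [_ /(congr1 (fun f => f 0))] := trace_Fword w ch.
by rewrite tr harm_word_const.
Qed.

End Energy.

(** * Extremal values of the derivative *)

Section Derivative.
Context {R : realType}.
Variables (q : 'I_3 -> R * R) (K : set (R * R)).
Variables (hb : 'I_3 -> R * R -> R).
Variable nu : 'I_3 -> {finite_measure set (R * R)%type -> \bar R}.
Hypothesis eqq : equilateral q.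
Hypothesis gasketK : is_gasket q K.
Hypothesis hb_energy : forall i, constant_energy q (hb i).
Hypothesis hb_corner : forall i j, hb i (q j) = (i == j)%:R.
Hypothesis nuP : forall i, is_energy_measure q K (hb i) (nu i).

Section OneFunction.
Variable h : R * R -> R.
Variable mu : {finite_measure set (R * R)%type -> \bar R}.
Hypothesis h_energy : constant_energy q h.
Hypothesis muP : is_energy_measure q K h mu.

Lemma cell_ratioE w :
  fine (mu (Fword q w @` K)) / fine (kusuoka nu (Fword q w @` K)) =
  cell_mass w (trace q h) / kusuoka_mass w.
Proof.
have -> : kusuoka nu (Fword q w @` K) = ((5 / 3) ^+ size w * kusuoka_mass w)%:E.
  rewrite /kusuoka /kusuoka_mass mulr_sumr -sumEFin; apply: eq_bigr => i _.
  rewrite (energy_measure_cell w (hb_energy i) (nuP i)).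
  congr (_ * cell_mass w _)%:E.
  by apply/funext => j; rewrite /trace hb_corner.
rewrite (energy_measure_cell w h_energy muP) /= -mulf_div divff ?mul1r //.
Qed.

(** A cell of level [n] at the vertex is one of the finitely many cells of level
    [size w] there, followed by repetitions of a single letter; by [vertex_flux]
    all these sequences of cells have the same limit, and being finitely many
    they converge uniformly. *)
Lemma RNderiv_vertex w i : RNderiv q K mu (kusuoka nu) (Fword q w (q i))
  (vertex_value (dual_word w (flux_fun i)) (trace q h)).
Proof.
have [b bP] := equilateral_barycentric eqq.
split; first by apply: (gasket_Fword gasketK); exact: (gasket_corner gasketK).
move=> C CP; set l := vertex_value _ _.
pose r (v : seq 'I_3) := cell_mass v (trace q h) / kusuoka_mass v.
apply/cvgrPdist_le => e e0.
have : \forall n \near \oo, forall vj : (size w).-tuple 'I_3 * 'I_3,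
    Fword q vj.1 (q vj.2) = Fword q w (q i) ->
    `|l - r (vj.1 ++ nseq n vj.2)| <= e.
  apply: filter_forall => -[v j] /=.
  have [e1|ne] := pselect (Fword q v (q j) = Fword q w (q i)); last first.
    by apply: nearW.
  have [c c0 vw] := vertex_flux gasketK bP e1.
  have := @cell_ratio_cvg R v j (trace q h).
  rewrite vw vertex_value_scale // => /cvgrPdist_le/(_ e e0).
  by apply: filterS.
move=> [N _ HN]; exists (N + size w)%N => // n /= Nn.
have [[u su Cn] _ Cx] := CP n; rewrite Cn cell_ratioE in Cx *.
have wu : (size w <= size u)%N by rewrite su (leq_trans _ Nn) // leq_addl.
have [j [uE vE]] := cell_at_vertex gasketK bP wu Cx.
rewrite uE.
have sv : size (take (size w) u) == size w by rewrite size_takel.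
by apply: (HN _ _ (Tuple sv, j)) => //=; rewrite leq_subRL // su addnC.
Qed.

(** Each point of the gasket has a sequence of cells, so its derivative is a
    limit of cell quotients. *)
Lemma RNderiv_bounds x l (m M : R) :
    (forall w, m <= cell_mass w (trace q h) / kusuoka_mass w <= M) ->
  RNderiv q K mu (kusuoka nu) x l -> m <= l <= M.
Proof.
move=> mM [Kx xl]; have [C CP] := cell_seq_exists gasketK Kx.
have {}xl := xl C CP.
have rP n : m <= fine (mu (C n)) / fine (kusuoka nu (C n)) <= M.
  by have [[w _ ->] _ _] := CP n; rewrite cell_ratioE.
apply/andP; split.
- by apply: (cvgr_to_ge xl); apply: nearW => n; have /andP[] := rP n.
- by apply: (cvgr_to_le xl); apply: nearW => n; have /andP[] := rP n.
Qed.

Lemma RNvalues_dense w (l : 'I_3 -> R) k : zero_sum l -> l k != 0 ->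
  exists2 V : nat -> R,
    forall n, RNvalues q K mu (kusuoka nu) (Fword q w @` K) (V n)
    & V @ \oo --> vertex_value l (trace q h).
Proof.
move=> l0 lk; have [W Wl] := vertex_value_dense w (trace q h) l0 lk.
eexists; last exact: Wl.
move=> n; exists (Fword q (w ++ (W n).1) (q (W n).2)); last exact: RNderiv_vertex.
rewrite Fword_cat; exists (Fword q (W n).1 (q (W n).2)) => //.
by apply: (gasket_Fword gasketK); exact: (gasket_corner gasketK).
Qed.

End OneFunction.

(** The identity of [cell_mass_split] divided by the Kusuoka measure and passed
    to the limit. *)
Lemma RNderiv_orthogonal h hp (mu mup : {finite_measure set (R * R)%type -> \bar R})
    x l :
    constant_energy q h -> is_energy_measure q K h mu ->
    constant_energy q hp -> is_energy_measure q K hp mup ->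
    edge_form (trace q hp) (trace q hp) = 1 ->
    edge_form (trace q h) (trace q hp) = 0 ->
    0 < edge_form (trace q h) (trace q h) ->
  RNderiv q K mu (kusuoka nu) x l ->
  RNderiv q K mup (kusuoka nu) x (3^-1 - l / edge_form (trace q h) (trace q h)).
Proof.
move=> ch muP chp mupP pp tp tt [Kx xl]; split=> // C CP.
have {}xl := xl C CP; set e := edge_form _ _ in tt *.
have -> : (fun n => fine (mup (C n)) / fine (kusuoka nu (C n))) =
    (fun n => 3^-1 - fine (mu (C n)) / fine (kusuoka nu (C n)) / e).
  apply/funext => n; have [[w _ ->] _ _] := CP n.
  rewrite (cell_ratioE ch muP) (cell_ratioE chp mupP).
  have split_w := cell_mass_split w pp tp.
  have T0 : kusuoka_mass w != 0 :> R by rewrite lt0r_neq0 ?kusuoka_mass_gt0.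
  have -> : cell_mass w (trace q h) =
      e / 3 * kusuoka_mass w - e * cell_mass w (trace q hp).
    by rewrite -split_w addrK.
  by field; rewrite T0 lt0r_neq0.
by apply: cvgB; [exact: cvg_cst|apply: cvgM => //; exact: cvg_cst].
Qed.

End Derivative.

Unset Implicit Arguments.

Theorem theorem3p5 (R : realType) (q : 'I_3 -> R * R) (SG : set (R * R))
    (hb : 'I_3 -> R * R -> R)
    (nu : 'I_3 -> {finite_measure set (R * R)%type -> \bar R})
    (h hperp : R * R -> R)
    (nu_h nu_hperp : {finite_measure set (R * R)%type -> \bar R})
    (a b c : R) (n : nat) (C : set (R * R)) :
  equilateral q ->
  is_gasket q SG ->
  (forall i, harmonic_on q SG (hb i)) ->
  (forall i j, hb i (q j) = (i == j)%:R) ->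
  (forall i, is_energy_measure q SG (hb i) (nu i)) ->
  harmonic_on q SG h ->
  ~ (exists k : R, forall x, SG x -> h x = k) ->
  is_energy_measure q SG h nu_h ->
  (forall A : set (R * R), measurable A ->
     nu_h A = (a%:E * nu 0%R A + b%:E * nu 1%R A + c%:E * nu 2%R A)%E) ->
  harmonic_on q SG hperp ->
  energy q hperp hperp = 1 ->
  energy q h hperp = 0 ->
  is_energy_measure q SG hperp nu_hperp ->
  is_cell q SG n C ->
  [/\ ereal_inf (EFin @` RNvalues q SG nu_h (kusuoka nu) C) = 0%E,
      ereal_sup (EFin @` RNvalues q SG nu_h (kusuoka nu) C)
        = (2 / 3 * (a + b + c))%:E
    & forall x, RNmax_at q SG nu_h (kusuoka nu) C x ->
                RNmin_at q SG nu_hperp (kusuoka nu) C x].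
Proof.
move=> eqq gK hbH hbq nuP hH hnc muP muE hpH hpE hhp mupP [w _ ->].
have [_ ch] := hH; have [_ chp] := hpH.
have chb i : constant_energy q (hb i) by have [] := hbH i.
set t := trace q h; set p := trace q hperp.
have pp : edge_form p p = 1 by rewrite -energy_edge_form.
have tp : edge_form t p = 0 by rewrite -energy_edge_form.
pose e := edge_form t t.
have e0 : 0 < e.
  rewrite lt_neqAle edge_form_ge0 andbT eq_sym; apply/eqP => t0.
  by apply: hnc; exact: constant_of_edge_form0 gK hH t0.
(* Compare total masses: each of the three basis functions has energy 2. *)
have eE : e = 2 * (a + b + c).
  have massK u mu : constant_energy q u -> is_energy_measure q SG u mu ->
      mu SG = (edge_form (trace q u) (trace q u))%:E.
    move=> cu uP; rewrite -[in LHS](image_id SG).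
    by rewrite (energy_measure_cell [::] cu uP) mul1r.
  have SGm : measurable SG by apply: closed_measurable_plane; exact: gasket_closed gK.
  have := muE SG SGm; rewrite (massK _ _ ch muP) !(massK _ _ (chb _) (nuP _)).
  move=> -[].
  rewrite -/t -/e !edge_formE /trace !hbq /= => ->; ring.
set N := kusuoka nu; set V := RNvalues q SG nu_h N (Fword q w @` SG).
have ratio_bounds v : 0 <= cell_mass v t / kusuoka_mass v <= e / 3.
  have T0 := kusuoka_mass_gt0 (R := R) v.
  apply/andP; split; first by rewrite divr_ge0 ?cell_mass_ge0 // ltW.
  rewrite ler_pdivrMr //.
  by rewrite -(cell_mass_split v pp tp) lerDl mulr_ge0 ?cell_mass_ge0 // ltW.
have perp_bounds v : 0 <= cell_mass v p / kusuoka_mass v <= 3^-1.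
  have T0 := kusuoka_mass_gt0 (R := R) v.
  apply/andP; split; first by rewrite divr_ge0 ?cell_mass_ge0 // ltW.
  rewrite ler_pdivrMr //.
  rewrite -(ler_pM2l e0) mulrA -(cell_mass_split v pp tp) lerDr.
  exact: cell_mass_ge0.
have V_bounds l : V l -> 0 <= l <= e / 3.
  by move=> [x _]; apply: (RNderiv_bounds gK chb hbq nuP ch muP).
(* The functional dual to [s] for the energy form: the formula for the derivative
   at a vertex gives [e / 3] on the dual of [t] and 0 on the dual of [p]. *)
pose centre (s : 'I_3 -> R) : 'I_3 -> R := fun j => s j - (\sum_(i < 3) s i) / 3.
have centre0 s : zero_sum (centre s).
  by rewrite /zero_sum /centre !sum_ord3; field.
have centre_dot s s' : dot (centre s) s' = edge_form s s' / 3.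
  by rewrite dotE edge_formE /centre !sum_ord3; field.
have centre_norm s : dot (centre s) (centre s) = edge_form s s / 3.
  by rewrite dotE edge_formE /centre !sum_ord3; field.
have centre_neq0 s : 0 < edge_form s s -> exists k, centre s k != 0.
  move=> s0; apply: contrapT => /forallNP c0.
  have {}c0 k : centre s k = 0 by apply/eqP/negPn/negP/c0.
  by move: (centre_norm s); rewrite dotE !c0; lra.
have [k tk] := centre_neq0 t e0.
have [k' pk] : exists k, centre p k != 0 by apply: centre_neq0; rewrite pp.
have [U UV Ucvg] := RNvalues_dense eqq gK chb hbq nuP ch muP w (centre0 p) pk.
have [U' UV' Ucvg'] := RNvalues_dense eqq gK chb hbq nuP ch muP w (centre0 t) tk.
have {}Ucvg : U @ \oo --> (0 : R).
  move: Ucvg; rewrite /vertex_value centre_dot edge_formC tp mul0r expr0n.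
  by rewrite mul0r.
have {}Ucvg' : U' @ \oo --> e / 3.
  move: Ucvg'; rewrite /vertex_value centre_dot centre_norm expr2 mulfK //.
  by rewrite mulf_neq0 ?invr_eq0 ?pnatr_eq0 // lt0r_neq0.
have -> : 2 / 3 * (a + b + c) = e / 3 by rewrite eE; field.
split.
- apply/eqP; rewrite eq_le; apply/andP; split; last first.
    by apply: le_ereal_inf_tmp => _ [l /V_bounds/andP[l0 _] <-]; rewrite lee_fin.
  apply/lee_addgt0Pr => d d0; rewrite add0e.
  have [m Um] : exists m, U m <= d.
    have : \forall n \near \oo, U n <= d by exact: cvgr_le Ucvg _ d0.
    by move=> [m _ Hm]; exists m; exact: Hm (leqnn m).
  apply: (@le_trans _ _ (U m)%:E); last by rewrite lee_fin.
  by apply: ereal_inf_lbound; exists (U m) => //; exact: UV.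
- apply/eqP; rewrite eq_le; apply/andP; split.
    by apply: ge_ereal_sup => _ [l /V_bounds/andP[_ l1] <-]; rewrite lee_fin.
  apply/lee_addgt0Pr => d d0.
  have [m Um] : exists m, e / 3 - d <= U' m.
    have : \forall n \near \oo, e / 3 - d <= U' n.
      by apply: cvgr_ge Ucvg' _ _; lra.
    by move=> [m _ Hm]; exists m; exact: Hm (leqnn m).
  apply: (@le_trans _ _ ((U' m)%:E + d%:E)%E).
    by rewrite -EFinD lee_fin -lerBlDr.
  by rewrite leeD2r //; apply: ereal_sup_ubound; exists (U' m) => //; exact: UV'.
- move=> x [Cx [l xl lmax]]; split=> //.
  have lE : l = e / 3.
    have Vl : V l by exists x.
    apply: le_anti; have /andP[_ ->] := V_bounds l Vl.
    by apply: (cvgr_to_le Ucvg'); apply: nearW => m; exact: lmax.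
  exists (3^-1 - l / e).
    exact: (RNderiv_orthogonal chb hbq nuP ch muP chp mupP pp tp e0 xl).
  have -> : 3^-1 - l / e = 0 by rewrite lE; field; rewrite lt0r_neq0.
  move=> l' [y _ yl'].
  suff /andP[//] : 0 <= l' <= 3^-1.
  exact: (RNderiv_bounds gK chb hbq nuP chp mupP perp_bounds yl').
Qed.
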